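(* Let $(X,T)$ be a totally minimal dynamical system. There exists a residual set $X' \subseteq X$ such that for all non-empty, open $U \subseteq X$, there exists $\eta > 0$ such that for all $x \in X'$, the set $R(x,U)$ satisfies $d^*_\times(R(x,U)) \geq \eta$.
   Context: $\mathbb{N}$ is the set of positive integers. A (topological dynamical) system $(X,T)$ is a compact metric space $X$ together with a continuous map $T: X \to X$ (not assumed invertible). It is minimal if for all $x \in X$ the set $\{T^n x \mid n \in \mathbb{N}\}$ is dense in $X$, and totally minimal if $(X,T^n)$ is minimal for every $n \in \mathbb{N}$. For $x \in X$ and $U \subseteq X$ non-empty and open, $R(x,U) = \{n \in \mathbb{N} \mid T^n x \in U\}$. A set is residual if it contains a dense $G_\delta$ set. The multiplicative upper Banach density of $A \subseteq \mathbb{N}$ is $$d^*_\times(A) = \limsup_{n \to \infty} \ \max_{m \in \mathbb{N}} \ \frac{|A \cap \{m p_1^{e_1} \cdots p_n^{e_n} \mid e_1, \ldots, e_n \in \{1, \ldots, n\}\}|}{n^n},$$ where $(p_n)_{n \in \mathbb{N}}$ is an enumeration of the primes (the value does not depend on the enumeration). Equivalently, $d^*_\times(A) = \sup\{\alpha \geq 0 \mid \forall F \subseteq \mathbb{N} \text{ finite}, \exists s \in \mathbb{N}, |sF \cap A| \geq \alpha |F|\}$. *)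

(* Defs.v *)
From HB Require Import structures.
From mathcomp Require Import all_boot all_order all_algebra finmap.
From mathcomp Require Import all_classical all_reals all_analysis borel_hierarchy.
Set Implicit Arguments.
Unset Strict Implicit.
Unset Printing Implicit Defensive.
Import Order.TTheory GRing.Theory Num.Theory.
Local Open Scope classical_set_scope.
Local Open Scope ring_scope.

Definition minimal (X : topologicalType) (T : X -> X) : Prop :=
  forall x : X, dense [set iter n T x | n in [set n : nat | (0 < n)%N]].

Definition totally_minimal (X : topologicalType) (T : X -> X) : Prop :=
  forall n : nat, (0 < n)%N -> minimal (iter n T).

Definition return_times (X : Type) (T : X -> X) (x : X) (U : set X) : set nat :=
  [set n : nat | (0 < n)%N /\ U (iter n T x)].

Definition residual (X : topologicalType) (A : set X) : Prop :=
  exists G : set X, [/\ Gdelta G, dense G & G `<=` A].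

(* Indices start at 0: [p 0, ..., p n.-1] are the primes written p_1, ..., p_n. *)
Definition prime_enumeration (p : nat -> nat) : Prop :=
  set_bij [set: nat] [set q : nat | prime q] p.

Definition prime_box (p : nat -> nat) (n m : nat) : set nat :=
  [set (m * \prod_(i < n) p i ^ e i)%N
     | e in [set e : 'I_n -> nat | forall i, (1 <= e i <= n)%N]].

(* [fset_set] sends infinite sets to the empty one; this does not occur in
   [box_frequency], since boxes are finite. *)
Lemma finite_prime_box (p : nat -> nat) (n m : nat) :
  finite_set (prime_box p n m).
Proof.
apply: (@sub_finite_set _ _
  [set (m * \prod_(i < n) p i ^ (f i).+1)%N | f in [set: {ffun 'I_n -> 'I_n}]]).
  move=> _ [e he <-].
  have h i : ((e i).-1 < n)%N by case/andP: (he i) => e0; rewrite prednK.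
  exists [ffun i => Ordinal (h i)] => //; congr muln; apply: eq_bigr => i _.
  by rewrite ffunE /= prednK //; case/andP: (he i).
exact/finite_image/finite_finset.
Qed.

Definition box_frequency (R : realType) (p : nat -> nat) (A : set nat)
    (n m : nat) : R :=
  #|` fset_set (A `&` prime_box p n m)|%:R / (n ^ n)%:R.

(* For each [n] the frequencies are integer multiples of 1/n^n in [0, 1], so the
   supremum over [m] is a maximum. *)
Definition mult_upper_banach_density (R : realType) (p : nat -> nat)
    (A : set nat) : \bar R :=
  limn_esup (fun n =>
    ereal_sup [set (box_frequency R p A n m)%:E | m in [set m : nat | (0 < m)%N]]).

(* Main.v *)
Require Import Defs.
From HB Require Import structures.
From mathcomp Require Import all_boot all_order all_algebra.
From mathcomp Require Import all_classical all_reals all_analysis.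
From mathcomp Require Import borel_hierarchy zify.
Import Order.TTheory GRing.Theory Num.Theory.
Local Open Scope classical_set_scope.
Local Open Scope ring_scope.

(** Fix an open set [U] that is not empty. By minimality and compactness there is
an [N] such that every orbit segment of length [N] meets [U]. The claim is that
for all finitely many positive integers [f e], the points [x] for which some
[s > 0] has [T^(s * f e) x] in [U] for at least a proportion 1/(2N) of the
indices [e] form a dense open set ([open_frequent_multiple],
[dense_frequent_multiple]). The proportion does not depend on the family [f].

For density, let [D] be the product of the [f e] and let [y] be any point. Each
orbit segment [T^(s * f e) y, ..., T^(s * f e + N - 1) y] meets [U]. Averaging
over [e] and over [s] in a long interval, and then choosing the best [i < N],
some [x = T^i y] has [T^(s * f e) x] in [U] for a proportion 1/N of the pairs
[(s, e)]. Since [T^D] is minimal, some [T^(k * D) x] lies in any prescribed open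
set. Passing from [x] to [T^(k * D) x] replaces [s] by [s + k * D / f e], a
translation of the interval of the [s] whose length is bounded
independently of that interval; a long enough interval loses less than half of
the pairs, and some single [s] then has the proportion 1/(2N) of the [e]. The
counting is [exists_frequent_time]. It is here that total minimality enters, and
the averaging over [s] is what allows a shift that depends on [e].

Applied to the products of prime powers in a box, the claim bounds every box frequency
of [return_times T x U] from below, because the elements of a box are pairwise
distinct by unique factorization ([box_frequency_ge]). Letting the box run over
all sizes and [U] over a countable base leaves countably many dense open sets,
whose intersection is dense by [compact_Baire] and serves as [X']. *)

(** * Averaging over a long interval of multipliers *)

Lemma leq_sum_shift (g : nat -> nat) (m n q L : nat) :
  (q <= L)%N -> (m + L <= n)%N ->
  (\sum_(m + L <= s < n) g s <= \sum_(m <= s < n) g (s + q)%N)%N.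
Proof.
move=> qL mLn; have := @big_addn _ 0%N addn m (n + q)%N q xpredT g.
rewrite addnK => <-.
rewrite (@big_cat_nat _ _ _ (m + L)%N (m + q)%N) ?leq_add2l //=; last by lia.
rewrite (@big_cat_nat _ _ _ n (m + L)%N (n + q)%N) ?leq_addr //=.
by rewrite addnCA leq_addr.
Qed.

(** Double counting: for fixed [s] and [e] the hypothesis on [P] gives a hit for
some [i < N], so [S] values of [s] give at least [S * #|E|] hits among the triples
[(i, s, e)]; the shifts [q i e] cost at most [L] values of [s] for each [e]. One
pair [(i, s)] does at least as well as the average over all of them. The shift may
depend on [e], which is what the application to [s + k * D / f e] requires. *)
Lemma exists_frequent_time (E : finType) (N L : nat) (f : E -> nat)
    (P : pred nat) (q : nat -> E -> nat) :
  (forall t, exists2 i, (i < N)%N & P (t + i)%N) ->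
  (forall i e, (i < N)%N -> (q i e <= L)%N) ->
  exists i s, [/\ (i < N)%N, (0 < s)%N &
    (#|E| <= 2 * N * \sum_(e : E) P ((s + q i e) * f e + i))%N].
Proof.
move=> hP hq; apply: contrapT => hno.
pose c i s := (\sum_(e : E) P ((s + q i e) * f e + i))%N.
have few i s : (i < N)%N -> (0 < s)%N -> (2 * N * c i s < #|E|)%N.
  move=> iN s0; rewrite ltnNge; apply/negP => h; apply: hno.
  by exists i, s; split.
have N0 : (0 < N)%N by have [i iN _] := hP 0%N; lia.
have E0 : (0 < #|E|)%N by have := few 0%N 1%N N0 isT; lia.
(* [S - L > S / 2]: at least half of the interval survives the shift, whence the
   factor 2 in the conclusion. *)
pose S := (2 * L).+1.
pose tot := (\sum_(i < N) \sum_(1 <= s < S.+1) c i s)%N.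
have upper : (2 * N * tot <= N * (S * #|E|.-1))%N.
  rewrite /tot big_distrr /=.
  have -> : (N * (S * #|E|.-1) = \sum_(i < N) S * #|E|.-1)%N.
    by rewrite sum_nat_const card_ord.
  apply: leq_sum => i _; rewrite big_distrr /=.
  have -> : (S * #|E|.-1 = \sum_(1 <= s < S.+1) #|E|.-1)%N.
    by rewrite sum_nat_const_nat subn1.
  rewrite big_nat [leqRHS]big_nat.
  by apply: leq_sum => s /andP[s0 _]; have := few i s (ltn_ord i) s0; lia.
have lower : (#|E| * (S - L) <= tot)%N.
  rewrite /tot /c.
  under eq_bigr do rewrite exchange_big /=.
  rewrite exchange_big /= -sum_nat_const; apply: leq_sum => e _.
  apply: (@leq_trans
    (\sum_(i < N) \sum_(1 + L <= s < S.+1) P (s * f e + i))%N); last first.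
    apply: leq_sum => i _.
    apply: (leq_sum_shift (fun s => nat_of_bool (P (s * f e + i)%N))).
      exact: hq.
    by rewrite /S; lia.
  rewrite exchange_big /=.
  have -> : (S - L = \sum_(1 + L <= s < S.+1) 1)%N.
    by rewrite sum_nat_const_nat muln1 add1n subSS.
  apply: leq_sum => s _; have [i iN Pi] := hP (s * f e)%N.
  by rewrite (bigD1 (Ordinal iN)) //= Pi.
suff : (N * (S * #|E|.-1) < 2 * N * (#|E| * (S - L)))%N.
  by move=> h; have := leq_trans h (leq_trans (leq_mul (leqnn _) lower) upper);
     rewrite ltnn.
rewrite (mulnC 2%N) -mulnA ltn_pmul2l // /S.
by move: E0; case: #|E| => // k _ /=; nia.
Qed.

(** * Compactness, Baire category and bounded return times *)

Lemma compact_seq_cluster {T : topologicalType} (u : nat -> T) :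
  compact [set: T] ->
  exists c : T, forall V, nbhs c V -> forall n, exists2 k, (n <= k)%N & V (u k).
Proof.
move=> /(_ (u @ \oo) _ filterT)[c [_ hc]]; exists c => V cV n.
have : (u @ \oo) (u @` [set k | (n <= k)%N]).
  by exists n => // k /= nk; exists k.
by move=> /hc /(_ cV) [_ [[k nk <-] Vk]]; exists k.
Qed.

(** Regularity gives nonempty open sets [W n] with the closure of [W n.+1] inside
[W n `&` F n]. A cluster point of any choice of points [u n] in [W n] lies in all
these closures; compactness takes the place of completeness. *)
Lemma compact_Baire {T : topologicalType} (F : nat -> set T) :
  hausdorff_space T -> compact [set: T] ->
  (forall n, open (F n) /\ dense (F n)) -> dense (\bigcap_n F n).
Proof.
move=> hT cT oF O O0 oO.
have step (nU : nat * set T) : exists U' : set T,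
    open nU.2 -> nU.2 !=set0 ->
    [/\ open U', U' !=set0 & closure U' `<=` nU.2 `&` F nU.1].
  case: nU => n U /=.
  have [oU|] := pselect (open U); last by exists U.
  have [U0|] := pselect (U !=set0); last by exists U.
  have [oFn dFn] := oF n.
  have [x UFx] := dFn U U0 oU.
  have oUF : open (U `&` F n) by exact: openI.
  have nUF : nbhs x (U `&` F n) by exact: open_nbhs_nbhs.
  have [B xB BUF] := compact_regular hT cT (@filterT _ (nbhs x) _) nUF.
  exists B° => _ _; split; first exact: open_interior.
    by exists x.
  by apply: subset_trans BUF; apply: closureS; exact: (@interior_subset _ B).
have [next nextP] := choice step.
pose W := fix W n := if n is k.+1 then next (k, W k) else O.
have WP n : open (W n) /\ W n !=set0.
  by elim: n => [//|n [oW W0]]; have [] := nextP (n, W n) oW W0.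
have WS n : closure (W n.+1) `<=` W n `&` F n.
  by have [oW W0] := WP n; have [] := nextP (n, W n) oW W0.
have W_decr m k : (m <= k)%N -> W k `<=` W m.
  elim: k => [|k IH]; first by rewrite leqn0 => /eqP ->.
  rewrite leq_eqVlt => /orP[/eqP -> //|mk].
  apply: subset_trans (IH mk); apply: subset_trans (@subset_closure _ _) _.
  by apply: subset_trans (WS k) _; exact: subIsetl.
have [u uP] := choice (fun n => (WP n).2).
have [c cP] := compact_seq_cluster u cT.
have cW n : closure (W n) c.
  move=> V cV; have [k nk Vk] := cP V cV n.
  by exists (u k); split => //; exact: W_decr nk _ (uP k).
exists c; split; first by have [] := WS 0%N c (cW 1%N).
by move=> n _; have [] := WS n c (cW n.+1).
Qed.

Lemma iter_continuous {T : topologicalType} (f : T -> T) (n : nat) :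
  continuous f -> continuous (iter n f).
Proof.
move=> cf; elim: n => [|n IH] x; first exact: (@cvg_id _ (nbhs x)).
exact: (@continuous_comp _ _ _ (iter n f) f x (IH x) (cf _)).
Qed.

(** If no bound worked, there would be points [u N] whose first [N] iterates avoid
[U]. A cluster point [c] of [u] enters [U] at some time [n], and by continuity so
do the points [u k] near [c], although some of these have [k > n]. *)
Lemma minimal_bounded_return {X : topologicalType} (T : X -> X) (U : set X) :
  compact [set: X] -> continuous T -> minimal T -> open U -> U !=set0 ->
  exists N, forall x, exists2 i, (i < N)%N & U (iter i T x).
Proof.
move=> cX cT mT oU U0; apply: contrapT => hno.
have bad N : exists x, forall i, (i < N)%N -> ~ U (iter i T x).
  apply: contrapT => h; apply: hno; exists N => x.
  apply: contrapT => hx; apply: h; exists x => i iN Ui; apply: hx.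
  by exists i.
have [u uP] := choice bad.
have [c cP] := compact_seq_cluster u cX.
have [z [Uz [n n0 nz]]] := mT c U U0 oU.
have nbhsU : nbhs c (iter n T @^-1` U).
  apply: (iter_continuous T n cT c); apply: open_nbhs_nbhs.
  by rewrite nz.
have [k nk] := cP _ nbhsU n.+1.
exact: uP.
Qed.

(** * Points returning along many multiples simultaneously *)

(** The family [f] stands for a finite set of positive integers; [N] is the inverse
of the required proportion. *)
Definition frequent_multiple {X : Type} (T : X -> X) (U : set X) (N : nat)
    {E : finType} (f : E -> nat) : set X :=
  [set x | exists2 s, (0 < s)%N &
     (#|E| <= N * #|[pred e | `[< U (iter (s * f e) T x) >]]|)%N].

(** By continuity, the finitely many hits for a given [s] persist near [x]; further
hits may appear there, which does no harm. *)
Lemma open_frequent_multiple {X : topologicalType} (T : X -> X) (U : set X)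
    (N : nat) {E : finType} (f : E -> nat) :
  continuous T -> open U -> open (frequent_multiple T U N f).
Proof.
move=> cT oU; rewrite openE => x [s s0 Ns].
have near_x : \forall z \near x,
    forall e, U (iter (s * f e) T x) -> U (iter (s * f e) T z).
  apply: filter_forall => e; have [Ue|nUe] := pselect (U (iter (s * f e) T x)).
    have : nbhs x (iter (s * f e) T @^-1` U).
      by apply: (iter_continuous T (s * f e) cT x); exact: open_nbhs_nbhs.
    by apply: filterS.
  exact: nearW.
apply: filterS near_x => z zU; exists s => //.
apply: leq_trans Ns _; rewrite leq_mul2l; apply/orP; right.
by apply/subset_leq_card/fintype.subsetP => e /asboolP Ue; exact/asboolP/zU.
Qed.

(** Minimality of [T^D], for [D] a common multiple of the [f e], carries each
[T^i y] into the open set at hand by a power of [T] that, for every [e], only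
translates the multiplier [s]. The translations for the finitely many [i < N] are
bounded, so that [exists_frequent_time] applies. *)
Lemma dense_frequent_multiple {X : topologicalType} (T : X -> X) (U : set X)
    (N : nat) {E : finType} (f : E -> nat) :
  totally_minimal T -> (forall e, 0 < f e)%N ->
  (forall x, exists2 i, (i < N)%N & U (iter i T x)) ->
  dense (frequent_multiple T U (2 * N) f).
Proof.
move=> mT f0 hN O [y Oy] oO.
pose D := (\prod_(e : E) f e)%N.
have D0 : (0 < D)%N by exact: prodn_gt0.
have fD e : (f e %| D)%N by rewrite /D (bigD1 e) //= dvdn_mulr.
have back i : exists k, O (iter (k * D + i) T y).
  have [z [Oz [k _ kz]]] := mT D D0 (iter i T y) O (ex_intro _ y Oy) oO.
  by exists k; rewrite iterD iterM kz.
have [k kO] := choice back.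
(* [T^(k i * D)] amounts to [q i e] more steps of [T^(f e)]. *)
pose q i e := (k i * (D %/ f e))%N.
have qL i e : (i < N)%N -> (q i e <= \sum_(j < N) k j * D)%N.
  move=> iN; rewrite (bigD1 (Ordinal iN)) //=.
  by apply: leq_trans (leq_addr _ _); rewrite leq_mul2l leq_div orbT.
have hP t : exists2 i, (i < N)%N & `[< U (iter (t + i) T y) >].
  have [i iN Ui] := hN (iter t T y).
  by exists i => //; apply/asboolP; rewrite addnC iterD.
have [i [s [_ s0 cnt]]] := exists_frequent_time E N _ f
  (fun t => `[< U (iter t T y) >]) q hP qL.
exists (iter (k i * D + i) T y); split; first exact: kO.
exists s => //; apply: leq_trans cnt _.
rewrite -sum1_card [in leqRHS]big_mkcond /= leq_mul2l; apply/orP; right.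
apply: leq_sum => e _; rewrite inE -iterD.
have -> : ((s + q i e) * f e + i = s * f e + (k i * D + i))%N.
  by rewrite mulnDl /q -mulnA divnK // addnA.
by case: asboolP.
Qed.

(** * Boxes of primes and box frequencies *)

Lemma logn_prod (q : nat) {I : finType} (F : I -> nat) :
  (forall i, 0 < F i)%N -> logn q (\prod_i F i) = (\sum_i logn q (F i))%N.
Proof.
move=> F0; pose K (a b : nat) := (0 < a)%N /\ logn q a = b.
suff [] : K (\prod_i F i)%N (\sum_i logn q (F i))%N by [].
apply: big_rec2 => [|i b a _ [a0 <-]]; first by rewrite /K logn1.
by split; [rewrite muln_gt0 F0 | rewrite lognM].
Qed.

(** Exponents in 1..n are encoded as ordinals below [n] plus one, so that the index
type has exactly [n ^ n] elements. *)
Definition box_gen (p : nat -> nat) (n : nat) (e : {ffun 'I_n -> 'I_n}) : nat :=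
  (\prod_(i < n) p i ^ (e i).+1)%N.

Lemma box_gen_gt0 (p : nat -> nat) (n : nat) (e : {ffun 'I_n -> 'I_n}) :
  prime_enumeration p -> (0 < box_gen p n e)%N.
Proof.
move=> [pP _ _]; apply: prodn_gt0 => i.
by rewrite expn_gt0 prime_gt0 //; exact: pP.
Qed.

(** Unique factorization: the exponents are recovered as valuations. *)
Lemma box_gen_inj (p : nat -> nat) (n : nat) :
  prime_enumeration p -> injective (@box_gen p n).
Proof.
move=> [pP pI _].
have p_prime i : prime (p i) by exact: pP.
have lognE (e : {ffun 'I_n -> 'I_n}) (i : 'I_n) : logn (p i) (box_gen p n e) = (e i).+1.
  rewrite logn_prod => [|j]; last by rewrite expn_gt0 prime_gt0.
  rewrite (bigD1 i) //= big1 ?addn0 => [|j ji]; first exact: pfactorK.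
  rewrite lognX logn_prime //; case: eqP => [pij|]; last by rewrite muln0.
  case/eqP: ji; apply/val_inj/esym; apply: pI pij; by rewrite inE.
move=> e1 e2 e12; apply/ffunP => i; apply/val_inj/succn_inj.
by rewrite -!lognE e12.
Qed.

Lemma box_frequency_ge (R : realType) (p : nat -> nat) (X : Type)
    (T : X -> X) (U : set X) (x : X) (N n s : nat) :
  prime_enumeration p -> (0 < N)%N -> (0 < s)%N ->
  (#|{ffun 'I_n -> 'I_n}| <=
     N * #|[pred e | `[< U (iter (s * box_gen p n e) T x) >]]|)%N ->
  N%:R^-1 <= box_frequency R p (return_times T x U) n s.
Proof.
move=> hp N0 s0; rewrite card_ffun card_ord; set B := [pred e | _] => cardB.
have nn0 : (0 < n ^ n)%N by rewrite expn_gt0; case: (n).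
rewrite /box_frequency ler_pdivlMr ?ltr0n // mulrC ler_pdivrMr ?ltr0n //.
rewrite -natrM ler_nat mulnC; apply: leq_trans cardB _.
rewrite leq_mul2l; apply/orP; right.
pose r := [seq (s * box_gen p n e)%N | e <- enum B].
have -> : #|B| = size r by rewrite size_map cardE.
apply: uniq_leq_size.
  rewrite map_inj_uniq ?enum_uniq // => e1 e2 /eqP.
  by rewrite eqn_pmul2l // => /eqP /(box_gen_inj _ _ hp).
move=> m /mapP [e]; rewrite mem_enum => /asboolP Ue ->.
rewrite in_fset_set; last first.
  by apply: sub_finite_set (finite_prime_box p n s); exact: subIsetr.
rewrite inE; split; first by split => //; rewrite muln_gt0 s0 box_gen_gt0.
by exists (fun i => (e i).+1) => // i; rewrite /= ltn_ord.
Qed.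

(** A bound for every box size, with a dilation factor [m] depending on the size, passes
to the limit superior. *)
Lemma mult_upper_banach_density_ge (R : realType) (p : nat -> nat)
    (A : set nat) (eta : R) :
  (forall n, exists2 m, (0 < m)%N & eta <= box_frequency R p A n m) ->
  (eta%:E <= mult_upper_banach_density R p A)%E.
Proof.
move=> h; apply: le_ereal_inf_tmp => b [V [k _ kV] <-].
have [m m0 hm] := h k.
apply: (@le_trans _ _ (box_frequency R p A k m)%:E); first by rewrite lee_fin.
apply: (@le_trans _ _ (ereal_sup
  [set (box_frequency R p A k m)%:E | m in [set m : nat | (0 < m)%N]])).
  by apply: ereal_sup_ubound; exists m.
by apply: ereal_sup_ubound; exists k => //; apply: kV => /=.
Qed.

(** * Countable base and conclusion *)

(** The balls of radius [k.+1%:R^-1] about the points of a dense sequence form a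
base up to interiors, so that a residual set needs only countably many conditions. *)
Lemma dense_seq_ball_subset {R : realType} {X : pseudoMetricType R}
    (d : nat -> X) (U : set X) :
  dense (range d) -> open U -> U !=set0 ->
  exists n k, ball (d n) k.+1%:R^-1 `<=` U.
Proof.
move=> dd oU [x Ux].
have /nbhs_ballP [_/posnumP[e] eU] : nbhs x U by exact: open_nbhs_nbhs.
have [//|k] := @ltr_add_invr R 0 (e%:num / 2) _; rewrite add0r => ke.
have [z []] : (ball x (e%:num / 2))° `&` range d !=set0.
  apply: dd; last exact: open_interior.
  by exists x; exact: nbhsx_ballx.
move=> /interior_subset xz [n _ nz]; exists n, k; rewrite nz => w zw.
apply: eU; rewrite [e%:num]splitr; apply: (ball_triangle xz).
exact: le_ball (ltW ke) _ zw.
Qed.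

Theorem theorem1p2 (R : realType) (p : nat -> nat)
    (hp : prime_enumeration p)
    (X : metricType R) (X_compact : compact [set: X])
    (T : X -> X) (T_continuous : continuous T)
    (T_totally_minimal : totally_minimal T) :
  exists X' : set X, residual X' /\
    forall U : set X, open U -> U !=set0 ->
      exists eta : R, 0 < eta /\
        forall x : X, X' x ->
          (eta%:E <= mult_upper_banach_density R p (return_times T x U))%E.
Proof.
have [[x0 _]|X0] := pselect ([set: X] !=set0); last first.
  exists setT; split.
    exists setT; split => //; first exact/open_Gdelta/openT.
    by move=> O [y _]; case: X0; exists y.
  by move=> U _ [y _]; case: X0; exists y.
have minT : minimal T by exact: (T_totally_minimal 1%N).
have orbit_dense : dense (range (fun n => iter n T x0)).
  move=> O O0 oO; have [z [Oz [n _ nz]]] := minT x0 O O0 oO.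
  by exists z; split => //; exists n.
pose V (ab : nat * nat) := (ball (iter ab.1 T x0) (ab.2.+1%:R^-1 : R))°.
have oV ab : open (V ab) by exact: open_interior.
have V0 ab : V ab !=set0.
  by exists (iter ab.1 T x0); apply: nbhsx_ballx; rewrite invr_gt0 ltr0n.
have [N NP] := choice (fun ab =>
  minimal_bounded_return T (V ab) X_compact T_continuous minT (oV ab) (V0 ab)).
have N0 ab : (0 < N ab)%N by have [i iN _] := NP ab x0; exact: leq_ltn_trans iN.
pose G (abn : nat * nat * nat) :=
  frequent_multiple T (V abn.1) (2 * N abn.1) (@box_gen p abn.2).
(* Enumerates the sets [G], with [setT] at the naturals that code no index. *)
pose F k := if @choice.unpickle (nat * nat * nat)%type k is Some abn then G abn else setT.
have oF k : open (F k) /\ dense (F k).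
  rewrite /F; case: choice.unpickle => [[ab n]|]; last first.
    by split; [exact: openT | move=> O O0 _; rewrite setIT].
  split; first exact: open_frequent_multiple.
  apply: dense_frequent_multiple => // e; exact: box_gen_gt0.
exists (\bigcap_k F k); split.
  exists (\bigcap_k F k); split => //; first by exists F => // k; case: (oF k).
  by apply: compact_Baire => //; exact: metric_hausdorff.
move=> U oU U0.
have [a [k abU]] := dense_seq_ball_subset _ _ orbit_dense oU U0.
have VU : V (a, k) `<=` U by apply: subset_trans abU; exact: interior_subset.
have N20 : (0 < 2 * N (a, k))%N by rewrite muln_gt0 N0.
exists (2 * N (a, k))%:R^-1; split; first by rewrite invr_gt0 ltr0n.
move=> x Fx; apply: mult_upper_banach_density_ge => n.
have : G (a, k, n) x by have := Fx (choice.pickle (a, k, n)) I; rewrite /F pickleK.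
move=> [s s0 cnt]; exists s => //; apply: box_frequency_ge => //.
apply: leq_trans cnt _; rewrite leq_mul2l; apply/orP; right.
by apply/subset_leq_card/fintype.subsetP => e /asboolP Ve; exact/asboolP/VU.
Qed.
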